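(* For every integer $k\geq 1$, we have $$\sum_{\boldsymbol{\lambda}\in S_k}x^{\ell(\boldsymbol{\lambda})}q^{|\boldsymbol{\lambda}|} =\sum_{i_1,\dots,i_k\geq0} \frac{q^{\sum_{a=1}^{k}a\binom{1+i_a}{2}+\sum_{1\leq a<b\leq k}a\,i_a i_b}}{(q;q)_{i_1}\cdots(q;q)_{i_k}}\,x^{\sum_{a=1}^{k}a\,i_a}.$$
   Context: A strict partition is a strictly decreasing finite sequence $\lambda=(\lambda_1,\dots,\lambda_\ell)$ of positive integers, $\lambda_1>\dots>\lambda_\ell\geq 1$ (the empty sequence, $\ell=0$, is allowed). Let $\mathsf{Str}$ be the set of strict partitions. The size of $\lambda$ is $|\lambda|=\lambda_1+\dots+\lambda_\ell$ and its length is $\ell(\lambda)=\ell$. When $\lambda$ is empty, one puts $\lambda_1=0$. For $k\geq 1$, $$S_k=\{\boldsymbol{\lambda}=(\lambda^{(1)},\dots,\lambda^{(k)})\in\mathsf{Str}^k \mid \ell(\lambda^{(i)})\geq (\lambda^{(i+1)})_1 \text{ for } 1\leq i<k\},$$ where $(\lambda^{(i+1)})_1$ is the first (largest) part of $\lambda^{(i+1)}$. For $\boldsymbol{\lambda}=(\lambda^{(1)},\dots,\lambda^{(k)})\in\mathsf{Str}^k$, put $|\boldsymbol{\lambda}|=|\lambda^{(1)}|+\dots+|\lambda^{(k)}|$ and $\ell(\boldsymbol{\lambda})=\ell(\lambda^{(1)})+\dots+\ell(\lambda^{(k)})$. For $n\in\mathbb{Z}_{\geq 0}$, $(q;q)_n=\prod_{j=1}^{n}(1-q^j)$.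 The identity is one of formal power series in $x$ and $q$. *)

(* Defs.v *)
From HB Require Import structures.
From mathcomp Require Import all_boot all_order all_algebra.
From mathcomp Require Import boolp classical_sets cardinality fsbigop.

Set Implicit Arguments.
Unset Strict Implicit.
Unset Printing Implicit Defensive.

Import GRing.Theory.
Local Open Scope ring_scope.
Local Open Scope classical_set_scope.

(* [fps R] is the ring R[[t]] of formal power series in one variable.  A
   record, so that no pointwise ring structure on [nat -> R] can be inferred. *)
Record fps (R : Type) := Fps { fcoef : nat -> R }.

Lemma fpsP (R : Type) (f g : fps R) : fcoef f =1 fcoef g <-> f = g.
Proof.
split=> [|->//]; case: f g => [f] [g] /= fg.
by congr Fps; apply: funext.
Qed.

HB.instance Definition _ (R : Type) := gen_eqMixin (fps R).
HB.instance Definition _ (R : Type) := gen_choiceMixin (fps R).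

Section FpsRing.
Variable R : comNzRingType.
Implicit Types f g h : fps R.

Definition fps_zero : fps R := Fps (fun=> 0).
Definition fps_opp f := Fps (fun n => - fcoef f n).
Definition fps_add f g := Fps (fun n => fcoef f n + fcoef g n).
Definition fps_one : fps R := Fps (fun n => (n == 0)%N%:R).
Definition fps_mul f g :=
  Fps (fun n => \sum_(i < n.+1) fcoef f i * fcoef g (n - i)%N).

Fact fps_addA : associative fps_add.
Proof. by move=> f g h; apply/fpsP => n; rewrite /= addrA. Qed.
Fact fps_addC : commutative fps_add.
Proof. by move=> f g; apply/fpsP => n; rewrite /= addrC. Qed.
Fact fps_add0 : left_id fps_zero fps_add.
Proof. by move=> f; apply/fpsP => n; rewrite /= add0r. Qed.
Fact fps_addN : left_inverse fps_zero fps_opp fps_add.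
Proof. by move=> f; apply/fpsP => n; rewrite /= addNr. Qed.

HB.instance Definition _ :=
  GRing.isZmodule.Build (fps R) fps_addA fps_addC fps_add0 fps_addN.

Definition fps_trunc m f : {poly R} := \poly_(i < m) fcoef f i.

Fact coef_trunc m f i : (i < m)%N -> (fps_trunc m f)`_i = fcoef f i.
Proof. by move=> im; rewrite coef_poly im. Qed.

Fact coef_fps_mul m f g n : (n < m)%N ->
  fcoef (fps_mul f g) n = (fps_trunc m f * fps_trunc m g)`_n.
Proof.
move=> nm; rewrite coefM /=; apply: eq_bigr => i _.
rewrite !coef_trunc//; first exact: leq_ltn_trans (leq_subr _ _) nm.
by apply: leq_ltn_trans nm; rewrite -ltnS.
Qed.

Fact fps_mulC : commutative fps_mul.
Proof.
by move=> f g; apply/fpsP => n; rewrite !(@coef_fps_mul n.+1)// mulrC.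
Qed.

Fact fps_mulA : associative fps_mul.
Proof.
move=> f g h; apply/fpsP => n.
transitivity ((fps_trunc n.+1 f * (fps_trunc n.+1 g * fps_trunc n.+1 h))`_n).
  rewrite coefM /=; apply: eq_bigr => i _.
  by rewrite -(@coef_fps_mul n.+1) ?coef_trunc// ltnS leq_subr.
rewrite mulrA coefM /=; apply: eq_bigr => i _.
by rewrite -(@coef_fps_mul n.+1) ?coef_trunc// ltnS leq_subr.
Qed.

Fact fps_mul1 : left_id fps_one fps_mul.
Proof.
move=> f; apply/fpsP => n.
by rewrite /= big_ord_recl /= mul1r subn0 big1 ?addr0// => i _; rewrite mul0r.
Qed.

Fact fps_mulDl : left_distributive fps_mul fps_add.
Proof.
move=> f g h; apply/fpsP => n; rewrite /= -big_split /=.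
by apply: eq_bigr => i _; rewrite mulrDl.
Qed.

Fact fps_oner_neq0 : fps_one != fps_zero.
Proof.
apply/eqP => /fpsP /(_ 0%N) /= /eqP; exact/negP/oner_neq0.
Qed.

HB.instance Definition _ := GRing.Zmodule_isComNzRing.Build (fps R)
  fps_mulA fps_mulC fps_mul1 fps_mulDl fps_oner_neq0.

Definition fps_unit : {pred fps R} := fun f => `[< exists g, g * f = 1 >].

Definition fps_inv f : fps R :=
  if pselect (exists g, g * f = 1) is left e then projT1 (cid e) else f.

Fact fps_mulVr : {in fps_unit, left_inverse 1 fps_inv *%R}.
Proof.
move=> f /asboolP fU; rewrite /fps_inv.
by case: pselect => // e; case: (cid e).
Qed.

Fact fps_unitPl f g : g * f = 1 -> fps_unit f.
Proof. by move=> gf; apply/asboolP; exists g. Qed.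

Fact fps_inv_out : {in [predC fps_unit], fps_inv =1 id}.
Proof.
move=> f /asboolPn fN; rewrite /fps_inv.
by case: pselect => // e; case: fN.
Qed.

HB.instance Definition _ := GRing.ComNzRing_hasMulInverse.Build (fps R)
  fps_mulVr fps_unitPl fps_inv_out.

Definition fpsX : fps R := Fps (fun n => (n == 1)%N%:R).
Definition fpsC (c : R) : fps R := Fps (fun n => if n == 0%N then c else 0).

Lemma fcoefD f g n : fcoef (f + g) n = fcoef f n + fcoef g n.
Proof. by []. Qed.

Lemma fcoefN f n : fcoef (- f) n = - fcoef f n.
Proof. by []. Qed.

Lemma fcoef1 n : fcoef (1 : fps R) n = (n == 0)%N%:R.
Proof. by []. Qed.

Lemma fcoefM f g n :
  fcoef (f * g) n = \sum_(i < n.+1) fcoef f i * fcoef g (n - i)%N.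
Proof. by []. Qed.

End FpsRing.

Section FpsUnit.
Variable R : comUnitRingType.

Fixpoint fps_inv_seq (f : fps R) n : seq R :=
  if n is m.+1 then
    let s := fps_inv_seq f m in
    rcons s (- (fcoef f 0)^-1 * \sum_(i < m.+1) fcoef f (m.+1 - i) * s`_i)
  else [:: (fcoef f 0)^-1].

(* The abstract inverse on [fps R] is the expected one: a series is invertible
   exactly when its constant coefficient is. *)
Lemma fps_unitE (f : fps R) : (f \is a GRing.unit) = (fcoef f 0 \is a GRing.unit).
Proof.
apply/idP/idP => [/mulVr /fpsP /(_ 0%N)|f0U].
  rewrite fcoefM big_ord1 /= => gf.
  by apply/unitrP; exists (fcoef f^-1 0); rewrite [in X in _ /\ X]mulrC gf.
have szs n : size (fps_inv_seq f n) = n.+1.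
  by elim: n => //= n IH; rewrite size_rcons IH.
have nths n i : (i <= n)%N -> (fps_inv_seq f n)`_i = (fps_inv_seq f i)`_i.
  elim: n => [|n IH]; first by rewrite leqn0 => /eqP ->.
  rewrite leq_eqVlt => /predU1P[->//|]; rewrite ltnS => i_n.
  by rewrite /= nth_rcons szs ltnS i_n IH.
suff : Fps (fun n => (fps_inv_seq f n)`_n) * f = 1.
  by move=> gf; apply/unitrPr; exists (Fps (fun n => (fps_inv_seq f n)`_n)); rewrite mulrC.
apply/fpsP => -[|n]; rewrite fcoefM fcoef1.
  by rewrite big_ord1 /= mulVr.
rewrite big_ord_recr /= subnn nth_rcons szs ltnn eqxx.
rewrite mulrAC mulNr mulVr// mulN1r; apply/eqP; rewrite subr_eq0; apply/eqP.
by apply: eq_bigr => i _; rewrite mulrC (nths n i) ?(leq_ord i).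
Qed.

End FpsUnit.

(* Z[[x, q]], represented as Z[[q]][[x]]. *)
Notation fps2 := (fps (fps int)).

Definition xvar : fps2 := fpsX (fps int).
Definition qvar : fps2 := fpsC (fpsX int).

Definition coef_xq (f : fps2) (a b : nat) : int := fcoef (fcoef f a) b.

(* Infinite sums of formal power series: each monomial x^a q^b may occur in
   only finitely many terms, and sums are computed coefficientwise.  On a
   family that is not summable, [fps_sum] is a junk value. *)
Definition fps_summable (I : choiceType) (A : set I) (F : I -> fps2) : Prop :=
  forall a b : nat, finite_set [set i | A i /\ coef_xq (F i) a b != 0].

Definition fps_sum (I : choiceType) (A : set I) (F : I -> fps2) : fps2 :=
  Fps (fun a => Fps (fun b => \sum_(i \in A) coef_xq (F i) a b)).

(* (q; q)_n *)
Definition qqpoch (n : nat) : fps2 := \prod_(1 <= j < n.+1) (1 - qvar ^+ j).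

Lemma qqpoch_unit n : qqpoch n \is a GRing.unit.
Proof.
rewrite /qqpoch big_nat; apply: rpred_prod => j /andP[j0 _].
suff qj0 : fcoef (fcoef (qvar ^+ j) 0) 0 = 0.
  rewrite !fps_unitE; have -> : fcoef (fcoef (1 - qvar ^+ j) 0) 0 =
    1 - fcoef (fcoef (qvar ^+ j) 0) 0 by [].
  by rewrite qj0 subr0 unitr1.
case: j j0 => // j _.
by rewrite exprS fcoefM big_ord1 fcoefM big_ord1 mul0r.
Qed.

Definition is_strict (s : seq nat) : bool := sorted gtn s && all (ltn 0) s.

Record strict_partition :=
  StrictPartition { parts :> seq nat; _ : is_strict parts }.

HB.instance Definition _ := [isSub for parts].
HB.instance Definition _ := [Countable of strict_partition by <:].

Definition psize (l : strict_partition) : nat := sumn l.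
Definition plength (l : strict_partition) : nat := size l.
Definition pfirst (l : strict_partition) : nat := head 0%N l.

(* k-tuples are indexed by 'I_k = {0, ..., k-1}, hence shifted by one. *)
Definition S_ (k : nat) : set {ffun 'I_k -> strict_partition} :=
  [set L | forall i j : 'I_k, j = i.+1 :> nat -> (pfirst (L j) <= plength (L i))%N].

Arguments S_ : clear implicits.

Definition total_size k (L : {ffun 'I_k -> strict_partition}) : nat :=
  (\sum_(i < k) psize (L i))%N.
Definition total_length k (L : {ffun 'I_k -> strict_partition}) : nat :=
  (\sum_(i < k) plength (L i))%N.

(* Main.v *)
Require Import Defs.
From HB Require Import structures.
From mathcomp Require Import all_boot all_order all_algebra.
From mathcomp Require Import boolp classical_sets cardinality fsbigop.
From mathcomp Require Import zify ring.

Set Implicit Arguments.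
Unset Strict Implicit.
Unset Printing Implicit Defensive.

Import GRing.Theory.
Local Open Scope ring_scope.
Local Open Scope classical_set_scope.

(** Group the tuples [L] in [S_ k] by their lengths [l_1, ..., l_k].  A strict
    partition satisfies length <= first part, so the condition defining [S_ k]
    forces [l_1 >= ... >= l_k], and these lengths are the same data as the
    differences [i_a = l_a - l_(a+1)] (with [l_(k+1) = 0]), which are the
    summation indices on the right.  Conversely [l_a] is the tail sum of [i]
    starting at [a], so exchanging summations gives the exponents:
    [sum_a l_a = sum_a a i_a] ([sum_tail]), and, from
    [C(1+m+n,2) = C(1+m,2) + m n + C(1+n,2)], the sum of the [C(1+l_a,2)] is the
    exponent of [q] on the right ([sum_bin_tail]).

    Once the lengths are fixed, the constraint on [L] decouples: the a-th
    partition only has to have length [l_a] and parts at most [l_(a-1)].  Hence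
    the generating function of these tuples is a product of generating functions
    of strict partitions with bounded parts ([sum_boxed_factor]), each of which is
    [q^C(1+l,2)] times the Gaussian binomial of [l_(a-1)] over [l_a]
    ([strict_gfE]).  The q-factorials of the [l_a] cancel along the chain, and
    only those of the differences [i_a] remain ([strict_gf_prod]).

    To keep all sums finite, the identity is proved one monomial [x^a q^b] at a
    time, with the parts of every partition bounded by [N = a + b].  This loses no
    tuple of size [b], and costs the first factor a ratio [(q;q)_N / (q;q)_(N-l_1)],
    which is [1] up to degree [N - l_1 >= b] ([fcoef_qpoch_ratio]). *)

(** * Coefficients of formal power series *)

Section FpsCoef.
Variable R : comNzRingType.
Implicit Types f g : fps R.

Lemma fcoef_sum (I : Type) (r : seq I) (P : pred I) (F : I -> fps R) n :
  fcoef (\sum_(i <- r | P i) F i) n = \sum_(i <- r | P i) fcoef (F i) n.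
Proof. by elim/big_rec2: _ => [//|i x y _ <-]. Qed.

Lemma fcoefMX f m n :
  fcoef (f * fpsX R ^+ m) n = if (m <= n)%N then fcoef f (n - m) else 0.
Proof.
elim: m f n => [|m IH] f n; first by rewrite expr0 mulr1 subn0.
rewrite exprS mulrA IH mulrC.
have fX p : fcoef (fpsX R * f) p = if p is q.+1 then fcoef f q else 0.
  case: p => [|p]; rewrite fcoefM big_ord_recl /= mul0r add0r ?big_ord0//.
  rewrite big_ord_recl /= mul1r subSS subn0 big1 ?addr0// => i _.
  by rewrite mul0r.
rewrite fX; case: (ltnP m n) => [mn|]; first by rewrite (ltnW mn) -(subnSK mn).
by rewrite leq_eqVlt => /predU1P[<-|nm]; rewrite ?leqnn ?subnn // leqNgt nm.
Qed.

Lemma fcoefX m n : fcoef (fpsX R ^+ m) n = (m == n)%:R.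
Proof.
rewrite -[_ ^+ m]mul1r fcoefMX fcoef1 subn_eq0.
by case: ltngtP.
Qed.

Fact fpsC_is_zmod_morphism : zmod_morphism (@fpsC R).
Proof.
by move=> c d; apply/fpsP => -[|n]; rewrite fcoefD fcoefN /= ?subr0.
Qed.

Fact fpsC_is_monoid_morphism : monoid_morphism (@fpsC R).
Proof.
split=> [|c d]; apply/fpsP => -[|n]; rewrite ?fcoefM ?big_ord1//=.
by rewrite big_ord_recl /= mulr0 add0r big1// => i _; rewrite mul0r.
Qed.

HB.instance Definition _ :=
  GRing.isZmodMorphism.Build R (fps R) (@fpsC R) fpsC_is_zmod_morphism.
HB.instance Definition _ :=
  GRing.isMonoidMorphism.Build R (fps R) (@fpsC R) fpsC_is_monoid_morphism.

Lemma fcoefCX c m n : fcoef (fpsC c * fpsX R ^+ m) n = if m == n then c else 0.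
Proof.
rewrite fcoefMX; case: (ltngtP m n) => [mn|//|->]; last by rewrite subnn.
by rewrite /= subn_eq0 leqNgt mn.
Qed.

End FpsCoef.

(** * q-factorials and strict partitions with bounded parts *)

Local Notation q := (fpsX int).

(** [qqpoch] already lives in Z[[q]]; there the coefficients can be handled
    without carrying the variable [x] along. *)
Definition qpoch (n : nat) : fps int := \prod_(1 <= j < n.+1) (1 - q ^+ j).

Lemma qpochS n : qpoch n.+1 = qpoch n * (1 - q ^+ n.+1).
Proof. by rewrite /qpoch big_nat_recr. Qed.

Lemma fpsC_qpoch n : fpsC (qpoch n) = qqpoch n.
Proof.
rewrite /qpoch /qqpoch rmorph_prod; apply: eq_bigr => j _.
by rewrite rmorphB rmorph1 rmorphXn.
Qed.

Lemma qpoch_unit n : qpoch n \is a GRing.unit.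
Proof. by have := qqpoch_unit n; rewrite -fpsC_qpoch fps_unitE. Qed.

(** The ratio is the product of the [1 - q^j] with [n < j <= m], which is [1]
    modulo [q^(n+1)]. *)
Lemma fcoef_qpoch_ratio n m (f : fps int) b : (b <= n)%N -> (n <= m)%N ->
  fcoef (f * (qpoch m / qpoch n)) b = fcoef f b.
Proof.
move=> bn; elim: m => [|m IH].
  by rewrite leqn0 => /eqP ->; rewrite divrr ?mulr1 ?qpoch_unit.
rewrite leq_eqVlt => /predU1P[->|]; first by rewrite divrr ?mulr1 ?qpoch_unit.
rewrite ltnS => nm.
rewrite qpochS mulrAC mulrA mulrBr mulr1 fcoefD fcoefN fcoefMX IH//.
by rewrite ltnNge (leq_trans bn nm) /= subr0.
Qed.

(** The strict partitions with parts at most [n], listed according to whether the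
    part [n] occurs: this recursion is the q-Pascal rule [strict_gfS]. *)
Fixpoint strict_upto (n : nat) : seq (seq nat) :=
  if n is m.+1 then strict_upto m ++ map (cons m.+1) (strict_upto m)
  else [:: [::]].

Lemma mem_strict_upto n s :
  (s \in strict_upto n) = is_strict s && (head 0 s <= n)%N.
Proof.
elim: n s => [|n IH] s /=.
  by case: s => [|[|x] s]; rewrite inE /is_strict /= ?andbF.
rewrite mem_cat IH; case: s => [|x s]; first by rewrite orTb.
have -> : (x :: s \in map (cons n.+1) (strict_upto n)) =
          (x == n.+1) && (s \in strict_upto n).
  apply/mapP/andP => [[t tn [-> ->]]|[/eqP -> sn]]; last by exists s.
  by rewrite eqxx.
have -> : is_strict (x :: s) = [&& 0 < x, is_strict s & (head 0 s < x)]%N.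
  rewrite /is_strict /=; case: s => [|y s] /=; first by rewrite andbT andbb.
  by case: (0 < x)%N; case: (y < x)%N; rewrite ?andbT ?andbF.
rewrite IH /=.
case: (is_strict s); rewrite ?andbF ?orbF ?andbT//=.
by apply/idP/idP; lia.
Qed.

Lemma strict_upto_uniq n : uniq (strict_upto n).
Proof.
elim: n => //= n IH; rewrite cat_uniq IH map_inj_uniq ?IH ?andbT; last by move=> ? ? [].
apply/hasPn => _ /mapP[s _ ->]; rewrite mem_strict_upto /=; lia.
Qed.

Definition strict_gf n l : fps int :=
  \sum_(s <- strict_upto n | size s == l) q ^+ sumn s.

Lemma strict_gfS n l :
  strict_gf n.+1 l = strict_gf n l + (if l is m.+1 then q ^+ n.+1 * strict_gf n m else 0).
Proof.
rewrite /strict_gf /= big_cat big_map /=; congr (_ + _).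
case: l => [|l]; first by rewrite big_pred0.
by rewrite mulr_sumr; apply: eq_bigr => s _; rewrite exprD.
Qed.

Lemma strict_gf_small n l : (n < l)%N -> strict_gf n l = 0.
Proof.
elim: n l => [|n IH] [|l]//; first by move=> _; rewrite /strict_gf /= big_cons big_nil ?addr0.
by rewrite ltnS strict_gfS => nl; rewrite !IH ?mulr0 ?addr0// ltnW.
Qed.

Lemma strict_gf0 n : strict_gf n 0 = 1.
Proof.
elim: n => [|n IH]; last by rewrite strict_gfS IH addr0.
by rewrite /strict_gf /= big_cons big_nil ?addr0.
Qed.

(** The q-binomial theorem: [strict_gf n l] is [q^C(1+l,2)] times the Gaussian
    binomial of [n] over [l], written without division.  The induction is the
    q-Pascal rule, on [l] and then on [d = n - l]. *)
Lemma strict_gfE l d :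
  strict_gf (l + d) l * (qpoch l * qpoch d) = q ^+ 'C(1 + l, 2) * qpoch (l + d).
Proof.
elim: l d => [|l IHl] d.
  by rewrite strict_gf0 /qpoch big_geq// !mul1r.
elim: d => [|d IHd].
  have := IHl 0%N; rewrite !addn0 [qpoch 0]big_geq// mulr1 => e.
  rewrite strict_gfS strict_gf_small// add0r.
  transitivity (q ^+ l.+1 * (1 - q ^+ l.+1) * (strict_gf l l * qpoch l)).
    by rewrite qpochS; ring.
  rewrite e qpochS !add1n [in RHS]binS bin1 exprD; ring.
have e1 := IHl d.+1.
rewrite addnS strict_gfS.
transitivity ((strict_gf (l.+1 + d) l.+1 * (qpoch l.+1 * qpoch d)) * (1 - q ^+ d.+1)
   + q ^+ (l.+1 + d).+1 * (1 - q ^+ l.+1) * (strict_gf (l + d.+1) l * (qpoch l * qpoch d.+1))).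
  by rewrite addSnnS !qpochS; ring.
rewrite IHd e1 (addSnnS l d) [qpoch (l + d.+1).+1]qpochS !add1n [in q ^+ 'C(l.+2, 2)]binS bin1.
by rewrite -addnS !exprD !exprS; ring.
Qed.

(** Multiplying the q-binomial formulas along a chain telescopes, since the factor
    [qpoch (M a.+1)] is the denominator of one step and the numerator of the next. *)
Lemma strict_gf_prod k (M : nat -> nat) : (forall a, M a.+1 <= M a)%N ->
  \prod_(a < k) strict_gf (M a) (M a.+1)
    * (\prod_(a < k) qpoch (M a - M a.+1)%N * qpoch (M k))
  = q ^+ (\sum_(a < k) 'C(1 + M a.+1, 2)) * qpoch (M 0%N).
Proof.
move=> Mle; elim: k => [|k IH]; first by rewrite !big_ord0 !mul1r.
rewrite !big_ord_recr /= exprD.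
have := strict_gfE (M k.+1) (M k - M k.+1); rewrite subnKC// => e.
set A := \prod_(i < k) _ in IH *; set B := \prod_(i < k) _ in IH *.
transitivity (A * B * (strict_gf (M k) (M k.+1) * (qpoch (M k.+1) * qpoch (M k - M k.+1)))).
  by ring.
by rewrite e mulrCA -[A * B * _]mulrA IH; ring.
Qed.

(** * Lengths as tail sums *)

(** With indices shifted by one, [tail i a] is the length [l_(a+1)] recovered from
    the differences [i]; it is defined for all natural [a] so that [tail i k = 0]
    closes the recursion. *)
Definition tail k (f : 'I_k -> nat) (a : nat) : nat := (\sum_(c < k | a <= c) f c)%N.

Lemma tail_rec k (f : 'I_k -> nat) (a : 'I_k) : tail f a = (f a + tail f a.+1)%N.
Proof.
rewrite /tail (bigD1 a)//=; congr addn; apply: eq_bigl => c.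
by rewrite -val_eqE /= [RHS]ltn_neqAle eq_sym andbC.
Qed.

Lemma tail_end k (f : 'I_k -> nat) : tail f k = 0%N.
Proof. by rewrite /tail big_pred0// => c; rewrite leqNgt ltn_ord. Qed.

Lemma tail_unique k (f : 'I_k -> nat) (g : nat -> nat) :
    (forall a : 'I_k, g a = (f a + g a.+1)%N) -> g k = 0%N ->
  forall a : 'I_k, g a = tail f a.
Proof.
move=> grec gk; suff gt d a : (a + d = k)%N -> g a = tail f a.
  by move=> a; apply: (gt (k - a)%N); rewrite subnKC// ltnW.
elim: d a => [|d IH] a; first by rewrite addn0 => ->; rewrite tail_end.
rewrite addnS -addSn => adk.
have ak : (a < k)%N by rewrite -adk leq_addr.
by rewrite (grec (Ordinal ak)) (tail_rec f (Ordinal ak)) /= (IH a.+1).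
Qed.

Lemma tail_noninc k (f : 'I_k -> nat) a : (tail f a.+1 <= tail f a)%N.
Proof.
rewrite [leqRHS](bigID (fun c : 'I_k => a < c)%N) /=; apply: leq_trans (leq_addr _ _).
apply/eq_leq/eq_bigl => c; apply/idP/andP => [ac|[]//].
by rewrite ac ltnW.
Qed.

(** The index [c] lies in the tails starting at [0, ..., c], which are [c.+1] in
    number. *)
Lemma sum_tail k (f : 'I_k -> nat) :
  (\sum_(a < k) tail f a = \sum_(c < k) c.+1 * f c)%N.
Proof.
rewrite (exchange_big_dep xpredT)//=; apply: eq_bigr => c _.
rewrite sum_nat_const; congr muln.
rewrite -sum1_card -(big_mkord (fun a => a <= c)%N (fun=> 1%N)).
rewrite (@big_cat_nat _ _ _ c.+1)//= big_nat_cond [X in (_ + X)%N]big_nat_cond.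
rewrite [X in (_ + X)%N]big_pred0 => [|a]; last by lia.
rewrite addn0 (eq_bigl (fun a => 0 <= a < c.+1)%N) => [|a]; last by lia.
by rewrite -big_nat sum_nat_const_nat muln1 subn0.
Qed.

Lemma bin2_addn m n : 'C(1 + (m + n), 2) = ('C(1 + m, 2) + m * n + 'C(1 + n, 2))%N.
Proof.
elim: m => [|m IH]; first by [].
by rewrite !add1n in IH *; rewrite addSn binS bin1 IH [in RHS]binS bin1; lia.
Qed.

(** Splitting off one term at a time shows that [C(1 + tail f a, 2)] is itself the
    tail sum of [g c = C(1 + f c, 2) + f c * tail f c.+1], so [sum_tail] applies to
    [g]. *)
Lemma sum_bin_tail k (f : 'I_k -> nat) :
  (\sum_(a < k) 'C(1 + tail f a, 2) =
   \sum_(a < k) a.+1 * 'C(1 + f a, 2)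
   + \sum_(a < k) \sum_(b < k | (a < b)%N) a.+1 * f a * f b)%N.
Proof.
pose g (c : 'I_k) := ('C(1 + f c, 2) + f c * tail f c.+1)%N.
rewrite (eq_bigr (fun a : 'I_k => tail g a)).
  rewrite sum_tail -big_split /=; apply: eq_bigr => c _.
  rewrite mulnDr; congr addn; rewrite mulnA big_distrr /=.
  exact: eq_bigr.
move=> a _; apply: (tail_unique (g := fun a => 'C(1 + tail f a, 2))) => [c|].
  by rewrite tail_rec bin2_addn.
by rewrite tail_end.
Qed.

(** The bound imposed on the parts of the a-th partition by the length of the
    previous one, [N] being the truncation imposed on the first. *)
Definition ceiling k (N : nat) (i : 'I_k -> nat) (a : nat) : nat :=
  if a is b.+1 then tail i b else N.

(** The coefficient of the power of [x] in the term of index [i] of the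
    right-hand side. *)
Definition fixed_jumps_gf k (i : 'I_k -> nat) : fps int :=
  q ^+ (\sum_(a < k) a.+1 * 'C(1 + i a, 2)
        + \sum_(a < k) \sum_(b < k | (a < b)%N) a.+1 * i a * i b)%N
  / \prod_(a < k) qpoch (i a).

(** The truncated product is the untruncated one times
    [qpoch N / qpoch (N - tail i 0)], which does not affect the degrees [<= b]. *)
Lemma fcoef_prod_strict_gf k N (i : 'I_k -> nat) b : (tail i 0 + b <= N)%N ->
  fcoef (\prod_(a < k) strict_gf (ceiling N i a) (tail i a)) b
    = fcoef (fixed_jumps_gf i) b.
Proof.
move=> iN; have i0N : (tail i 0 <= N)%N by apply: leq_trans iN; apply: leq_addr.
have Mle a : (ceiling N i a.+1 <= ceiling N i a)%N.
  by case: a => [//|a]; apply: tail_noninc.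
have := strict_gf_prod k Mle.
have -> : \prod_(a < k) qpoch (ceiling N i a - ceiling N i a.+1) * qpoch (ceiling N i k)
    = qpoch (N - tail i 0) * \prod_(a < k) qpoch (i a).
  (* [ceiling N i k.+1 = 0], so the leftover factor of the telescoping is one more
     term of the same product. *)
  have -> : ceiling N i k = (ceiling N i k - ceiling N i k.+1)%N.
    by rewrite /= tail_end subn0.
  rewrite -(big_ord_recr k (fun a => qpoch (ceiling N i a - ceiling N i a.+1))).
  rewrite big_ord_recl; congr (_ * _); apply: eq_bigr => a _.
  by rewrite /bump /= tail_rec addnK.
rewrite [ceiling N i 0]/= sum_bin_tail => e.
rewrite -(@fcoef_qpoch_ratio (N - tail i 0) N (fixed_jumps_gf i)) ?leq_subr//; last first.
  by rewrite leq_subRL.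
have BU : \prod_(a < k) qpoch (i a) \is a GRing.unit.
  by apply: rpred_prod => a _; apply: qpoch_unit.
congr (fcoef _ b); apply: (mulIr (qpoch_unit (N - tail i 0))).
apply: (mulIr BU); rewrite -[LHS]mulrA [LHS]e /fixed_jumps_gf.
by rewrite mulrA divrK ?qpoch_unit// mulrAC divrK.
Qed.

(** * A finite model of the strict partitions *)

Lemma plength_le_pfirst (s : strict_partition) : (plength s <= pfirst s)%N.
Proof.
case: s => s; rewrite /is_strict /plength /pfirst /=.
elim: s => [//|x [|y s] IH] /=; first by rewrite andbT.
case/andP=> /andP[yx ys] /and3P[x0 y0 s0]; apply: leq_ltn_trans yx.
by apply: IH; rewrite /= ys y0.
Qed.

Lemma pfirst_le_psize (s : strict_partition) : (pfirst s <= psize s)%N.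
Proof. by case: s => [[|x s] ?]//; apply: leq_addr. Qed.

Definition bounded_strict N : seq strict_partition := pmap insub (strict_upto N).

Lemma mem_bounded_strict N s : (s \in bounded_strict N) = (pfirst s <= N)%N.
Proof. by rewrite mem_pmap_sub mem_strict_upto (valP s). Qed.

Lemma bounded_strict_uniq N : uniq (bounded_strict N).
Proof. exact/pmap_sub_uniq/strict_upto_uniq. Qed.

Lemma map_parts_bounded_strict N : map parts (bounded_strict N) = strict_upto N.
Proof.
rewrite /bounded_strict (pmap_filter (insubK _)); apply/all_filterP/allP => s.
by rewrite mem_strict_upto isSome_insub => /andP[].
Qed.

Lemma sum_seq_sub (T : choiceType) (V : nmodType) (s : seq T) (P : pred T) (F : T -> V) :
  uniq s -> \sum_(x : seq_sub s | P (val x)) F (val x) = \sum_(x <- s | P x) F x.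
Proof.
move=> us; rewrite -[in RHS](val_seq_sub_enum us) big_map.
have -> : seq_sub_enum s = Finite.enum (seq_sub s) by rewrite unlock.
by rewrite [index_enum _]unlock.
Qed.

Lemma strict_gf_bounded N n l : (n <= N)%N ->
  \sum_(s <- bounded_strict N | (plength s == l) && (pfirst s <= n)%N) q ^+ psize s
  = strict_gf n l.
Proof.
move=> nN; rewrite /strict_gf -map_parts_bounded_strict big_map.
rewrite -big_filter_cond -big_filter -filter_predI.
rewrite -[RHS]big_filter; apply: perm_big; apply: uniq_perm.
- exact/filter_uniq/bounded_strict_uniq.
- exact/filter_uniq/bounded_strict_uniq.
move=> s; rewrite !mem_filter /= !mem_bounded_strict.
rewrite -/(plength s) andbAC andbC; congr andb.
by apply/andP/idP => [[]//|sn]; rewrite sn (leq_trans sn).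
Qed.

(** The distributivity of products over sums needs a finite index type, which is
    the role of [boxed N]. *)
Definition boxed N := seq_sub (bounded_strict N).

Definition unbox k N (t : {ffun 'I_k -> boxed N}) : {ffun 'I_k -> strict_partition} :=
  [ffun a => val (t a)].

Lemma unbox_inj k N : injective (@unbox k N).
Proof.
by move=> t u /ffunP e; apply/ffunP => a; apply: val_inj; have := e a; rewrite !ffunE.
Qed.

Lemma pfirst_unbox k N (t : {ffun 'I_k -> boxed N}) a : (pfirst (unbox t a) <= N)%N.
Proof. by rewrite ffunE -mem_bounded_strict; apply: valP. Qed.

Lemma unbox_surj k N (L : {ffun 'I_k -> strict_partition}) :
  (forall a, pfirst (L a) <= N)%N -> exists t : {ffun 'I_k -> boxed N}, unbox t = L.
Proof.
move=> LN; have LB a : L a \in bounded_strict N by rewrite mem_bounded_strict.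
by exists [ffun a => SeqSub (LB a)]; apply/ffunP => a; rewrite !ffunE.
Qed.

(** With the lengths fixed, the conditions on the different components of [t] are
    independent. *)
Lemma sum_boxed_factor k N (i : 'I_k -> nat) : (tail i 0 <= N)%N ->
  \sum_(t : {ffun 'I_k -> boxed N} |
      [forall a, (plength (unbox t a) == tail i a)
                 && (pfirst (unbox t a) <= ceiling N i a)%N])
    q ^+ total_size (unbox t)
  = \prod_(a < k) strict_gf (ceiling N i a) (tail i a).
Proof.
move=> iN; pose Q (a : 'I_k) : pred (boxed N) := fun x =>
  (plength (val x) == tail i a) && (pfirst (val x) <= ceiling N i a)%N.
transitivity (\prod_(a < k) \sum_(x | Q a x) q ^+ psize (val x)).
  rewrite bigA_distr_big_dep; apply: eq_big => [t|t _].
    apply/forallP/familyP => tQ a; have := tQ a; rewrite ffunE //.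
  by rewrite /total_size prodrXr; congr (_ ^+ _); apply: eq_bigr => a _; rewrite ffunE.
apply: eq_bigr => a _; rewrite -(@strict_gf_bounded N).
  rewrite -(sum_seq_sub (fun s => (plength s == tail i a) && (pfirst s <= ceiling N i a)%N)
    (fun s => q ^+ psize s)) //.
  exact: bounded_strict_uniq.
case: a => -[|a] //= _; apply: leq_trans iN.
by elim: a => // a; apply: leq_trans; apply: tail_noninc.
Qed.

(** * Tuples in S_k and their length differences *)

(** The length of the a-th component, extended by [0] to [a >= k]. *)
Definition len k (L : {ffun 'I_k -> strict_partition}) (a : nat) : nat :=
  oapp (fun j => plength (L j)) 0%N (insub a).

Lemma lenE k (L : {ffun 'I_k -> strict_partition}) (a : 'I_k) : len L a = plength (L a).
Proof. by rewrite /len valK. Qed.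

Lemma len_end k (L : {ffun 'I_k -> strict_partition}) a : (k <= a)%N -> len L a = 0%N.
Proof. by move=> ka; rewrite /len insubF// ltnNge ka. Qed.

Definition jumps k (L : {ffun 'I_k -> strict_partition}) : {ffun 'I_k -> nat} :=
  [ffun a : 'I_k => (len L a - len L a.+1)%N].

(** Along a tuple of [S_ k] one has
    [plength (L a.+1) <= pfirst (L a.+1) <= plength (L a)]; hence the truncated
    subtractions in [jumps] are exact and the lengths are their tail sums. *)
Lemma plength_jumps k (L : {ffun 'I_k -> strict_partition}) (a : 'I_k) :
  S_ k L -> plength (L a) = tail (jumps L) a.
Proof.
move=> LS; rewrite -lenE; apply: (tail_unique (g := len L)); last by rewrite len_end.
move=> c; rewrite ffunE subnK//; case: (ltnP c.+1 k) => [ck|kc]; last by rewrite len_end.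
rewrite (lenE L c) (lenE L (Ordinal ck)).
by apply: leq_trans (LS c (Ordinal ck) erefl); apply: plength_le_pfirst.
Qed.

Lemma total_length_jumps k (L : {ffun 'I_k -> strict_partition}) :
  S_ k L -> total_length L = (\sum_(a < k) a.+1 * jumps L a)%N.
Proof.
by move=> LS; rewrite -sum_tail; apply: eq_bigr => a _; apply: plength_jumps.
Qed.

(** The decoupling: once the differences of lengths are prescribed, membership in
    [S_ k] becomes a condition on each component separately. *)
Lemma S_jumpsP k N (L : {ffun 'I_k -> strict_partition}) (i : {ffun 'I_k -> nat}) :
    (forall a, pfirst (L a) <= N)%N ->
  (L \in S_ k) && (jumps L == i) =
  [forall a, (plength (L a) == tail i a) && (pfirst (L a) <= ceiling N i a)%N].
Proof.
move=> LN; apply/andP/forallP => [[/set_mem LS /eqP <-] a|Li].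
  rewrite plength_jumps// eqxx /=; case: a => -[|a] ak //=.
  have := LS (Ordinal (ltnW ak)) (Ordinal ak) erefl.
  by rewrite plength_jumps.
have Lt a : plength (L a) = tail i a by have /andP[/eqP] := Li a.
split.
  apply/mem_set => a [b bk] /= eb; have /andP[_] := Li (Ordinal bk).
  by rewrite Lt; move: bk; rewrite eb.
apply/eqP/ffunP => a; rewrite ffunE lenE Lt tail_rec.
suff -> : len L a.+1 = tail i a.+1 by rewrite addnK.
case: (ltnP a.+1 k) => [ak|ka]; first by rewrite (lenE L (Ordinal ak)) Lt.
rewrite len_end//; have -> : a.+1 = k by apply/eqP; rewrite eqn_leq ka ltn_ord.
by rewrite tail_end.
Qed.

(** * The identity, one monomial at a time *)

Lemma coef_xq_monomial (c : fps int) m a b :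
  coef_xq (fpsC c * xvar ^+ m) a b = if m == a then fcoef c b else 0.
Proof. by rewrite /coef_xq fcoefCX; case: eqP. Qed.

Lemma le_weighted_sum k (i : 'I_k -> nat) a : (i a <= \sum_(c < k) c.+1 * i c)%N.
Proof. by rewrite (bigD1 a)//=; apply: leq_trans (leq_addr _ _); rewrite mulSn leq_addr. Qed.

Lemma tail0_le_weighted_sum k (i : 'I_k -> nat) : (tail i 0 <= \sum_(c < k) c.+1 * i c)%N.
Proof. by apply: leq_sum => c _; rewrite mulSn leq_addr. Qed.

Lemma pfirst_le_total_size k (L : {ffun 'I_k -> strict_partition}) a :
  (pfirst (L a) <= total_size L)%N.
Proof.
by apply: leq_trans (pfirst_le_psize _) _; rewrite /total_size (bigD1 a)//= leq_addr.
Qed.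

(** Only indices with [sum_c c i_c = a] contribute to [x^a], and these have entries
    at most [a]: they all come from [{ffun 'I_k -> 'I_a.+1}]. *)
Definition widen_fun k m (j : {ffun 'I_k -> 'I_m}) : {ffun 'I_k -> nat} :=
  [ffun c => nat_of_ord (j c)].

Lemma widen_fun_inj k m : injective (@widen_fun k m).
Proof.
by move=> i j /ffunP e; apply/ffunP => c; apply: val_inj; have := e c; rewrite !ffunE.
Qed.

Lemma widen_fun_surj k m (i : {ffun 'I_k -> nat}) :
  (forall c, i c <= m)%N -> exists j : {ffun 'I_k -> 'I_m.+1}, widen_fun j = i.
Proof.
move=> im; exists [ffun c => inord (i c)].
by apply/ffunP => c; rewrite !ffunE inordK ?ltnS ?im.
Qed.

Lemma sum_boxed_fixed_jumps k N (i : {ffun 'I_k -> nat}) b : (tail i 0 + b <= N)%N ->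
  \sum_(t : {ffun 'I_k -> boxed N} | (unbox t \in S_ k) && (jumps (unbox t) == i))
     fcoef (q ^+ total_size (unbox t)) b = fcoef (fixed_jumps_gf i) b.
Proof.
move=> iN; rewrite -(fcoef_prod_strict_gf iN) -sum_boxed_factor; last first.
  by apply: leq_trans iN; apply: leq_addr.
rewrite fcoef_sum; apply: eq_bigl => t.
by rewrite (@S_jumpsP _ N)// => a; apply: pfirst_unbox.
Qed.

(** The coefficient of [x^a q^b] on both sides of the theorem, as finite sums; the
    left one is partitioned according to [jumps]. *)
Lemma sum_boxed_by_jumps k a b :
  \sum_(t : {ffun 'I_k -> boxed (a + b)%N} |
      (unbox t \in S_ k) && (total_length (unbox t) == a))
     fcoef (q ^+ total_size (unbox t)) b
  = \sum_(j : {ffun 'I_k -> 'I_a.+1} | (\sum_(c < k) c.+1 * widen_fun j c == a)%N)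
     fcoef (fixed_jumps_gf (widen_fun j)) b.
Proof.
pose p (t : {ffun 'I_k -> boxed (a + b)%N}) : {ffun 'I_k -> 'I_a.+1} := [ffun c => inord (jumps (unbox t) c)].
have pE t j : unbox t \in S_ k ->
    total_length (unbox t) = a -> (p t == j) = (jumps (unbox t) == widen_fun j).
  move=> /set_mem tS ta; rewrite -(inj_eq (@widen_fun_inj _ _)); congr (_ == _).
  apply/ffunP => c; rewrite !ffunE inordK// ltnS -[X in (_ <= X)%N]ta.
  rewrite total_length_jumps//; have := le_weighted_sum (jumps (unbox t)) c.
  by rewrite {1}/jumps ffunE.
rewrite (partition_big p (fun j => \sum_(c < k) c.+1 * widen_fun j c == a)%N).
  apply: eq_bigr => j /eqP ja; rewrite -(@sum_boxed_fixed_jumps _ (a + b)); last first.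
    by rewrite leq_add2r -[X in (_ <= X)%N]ja tail0_le_weighted_sum.
  apply: eq_bigl => t; apply/idP/idP => [/andP[/andP[tS /eqP ta]]|].
    by rewrite pE// tS.
  move=> /andP[tS tj]; have ta : total_length (unbox t) = a.
    by rewrite total_length_jumps ?(eqP tj)//; apply: set_mem.
  by rewrite tS ta eqxx pE.
move=> t /andP[tS /eqP ta]; have := pE t (p t) tS ta; rewrite eqxx => /esym/eqP <-.
by rewrite -total_length_jumps ?ta//; apply: set_mem.
Qed.

Theorem theorem2p2 (k : nat) (k_ge1 : (1 <= k)%N) :
  let lhs_term (L : {ffun 'I_k -> strict_partition}) : fps2 :=
    xvar ^+ total_length L * qvar ^+ total_size L in
  let rhs_term (i : {ffun 'I_k -> nat}) : fps2 :=
    qvar ^+ (\sum_(a < k) a.+1 * 'C(1 + i a, 2)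
             + \sum_(a < k) \sum_(b < k | (a < b)%N) a.+1 * i a * i b)%N
    / (\prod_(a < k) qqpoch (i a))
    * xvar ^+ (\sum_(a < k) a.+1 * i a)%N in
  [/\ fps_summable (S_ k) lhs_term,
      fps_summable [set: {ffun 'I_k -> nat}] rhs_term &
      fps_sum (S_ k) lhs_term = fps_sum [set: {ffun 'I_k -> nat}] rhs_term].
Proof.
move=> lhs_term rhs_term.
have lhsE L a b : coef_xq (lhs_term L) a b =
    if total_length L == a then fcoef (q ^+ total_size L) b else 0.
  by rewrite /lhs_term mulrC /qvar -rmorphXn coef_xq_monomial.
have rhsE i a b : coef_xq (rhs_term i) a b =
    if (\sum_(c < k) c.+1 * i c == a)%N then fcoef (fixed_jumps_gf i) b else 0.
  rewrite -coef_xq_monomial /rhs_term /fixed_jumps_gf rmorphM rmorphXn rmorphV; last first.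
    by apply: rpred_prod => c _; apply: qpoch_unit.
  by rewrite rmorph_prod (eq_bigr _ (fun c _ => fpsC_qpoch (i c))).
have lhs_supp N L a b : (b <= N)%N -> coef_xq (lhs_term L) a b != 0 ->
    exists t : {ffun 'I_k -> boxed N}, unbox t = L.
  move=> bN; rewrite lhsE; case: ifP; rewrite ?eqxx// fcoefX => _.
  case: (total_size L =P b) => [Lb _|]; rewrite ?eqxx//.
  apply: unbox_surj => c; apply: leq_trans bN; rewrite -Lb.
  exact: pfirst_le_total_size.
have rhs_supp i a b : coef_xq (rhs_term i) a b != 0 ->
    exists j : {ffun 'I_k -> 'I_a.+1}, widen_fun j = i.
  rewrite rhsE; case: ifP; rewrite ?eqxx// => /eqP ia _.
  by apply: widen_fun_surj => c; rewrite -ia le_weighted_sum.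
split.
- move=> a b; apply: (@sub_finite_set _ _ (range (@unbox k b))).
    by move=> L [_ /(lhs_supp b)] => /(_ (leqnn b))[t <-]; exists t.
  apply: finite_image; exact: finite_finset.
- move=> a b; apply: (@sub_finite_set _ _ (range (@widen_fun k a.+1))).
    by move=> i [_ /rhs_supp[j <-]]; exists j.
  apply: finite_image; exact: finite_finset.
apply/fpsP => a; apply/fpsP => b /=.
pose r := [seq unbox t | t <- enum {ffun 'I_k -> boxed (a + b)%N} & unbox t \in S_ k].
rewrite (fsbigE r); first last.
- move=> L LS; apply: contraNeq => /(lhs_supp (a + b)%N).
  rewrite leq_addl => /(_ isT)[t tL]; apply/mapP; exists t => //.
  by rewrite mem_filter tL mem_enum (mem_set LS).
- by move=> L /mapP[t]; rewrite mem_filter => /andP[/set_mem tS _ ->].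
- by rewrite (map_inj_uniq (@unbox_inj _ _)) filter_uniq ?enum_uniq.
rewrite (@fsbigE _ _ _ _ _ [seq widen_fun j | j <- enum {ffun 'I_k -> 'I_a.+1}]) //; first last.
- move=> i _; apply: contraNeq => /rhs_supp[j <-].
  by rewrite map_f ?mem_enum.
- by rewrite (map_inj_uniq (@widen_fun_inj _ _)) enum_uniq.
rewrite !big_map big_filter_cond !big_enum_cond -enumT big_enum_cond.
rewrite (eq_bigr _ (fun t _ => lhsE (unbox t) a b)) -big_mkcondr /=.
rewrite [RHS](eq_bigr _ (fun j _ => rhsE (widen_fun j) a b)) -big_mkcondr /=.
apply: etrans (etrans (sum_boxed_by_jumps k a b) _); apply: eq_bigl => j.
  by rewrite andbb.
by rewrite (mem_set (I : [set: _] (widen_fun j))).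
Qed.
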